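(* Let $k,k'\geq 1$ be arbitrary natural numbers. The following statements hold, where ''FC of order $k|\ell$'' and ''the Frankl conjecture'' denote the assertions defined in the context. (1) If FC of order $k|1$ and FC of order $k'|1$ are both valid, then FC of order $k+k'|1$ is valid. In particular, if the Frankl conjecture is valid, then FC of order $k|1$ is valid. (2) If FC of order $k|k$ and FC of order $k'|k'$ are both valid, then FC of order $k+k'|k+k'$ is valid. In particular, if the Frankl conjecture is valid, then FC of order $k|k$ is valid.
   Context: For a finite nonempty set $X$, a union-closed family on $X$ is a set $\mathcal{A}\subseteq\mathcal{P}(X)$ of subsets of $X$ such that $\emptyset,X\in\mathcal{A}$, and such that $A_1,A_2\in\mathcal{A}$ implies $A_1\cup A_2\in\mathcal{A}$. If $\mathcal{A}$ is a union-closed family on $X$, then $X$ is denoted by $\cup\mathcal{A}$. The class of all union-closed families on finite nonempty sets is denoted by $\mathfrak{A}$. $|S|$ denotes the cardinality of a set $S$. The Frankl conjecture is the assertion: if $\mathcal{A}$ is a union-closed family on a finite nonempty set $X$, then there exists $x\in X$ such that $x$ belongs to at least half of the members of $\mathcal{A}$. Let $k,\ell$ be natural numbers with $k\geq\ell\geq1$. A family $\mathcal{A}\in\mathfrak{A}$ is called $k|\ell$-separated if $|\cup\mathcal{A}|\geq k$ and for every $k$ distinct elements $x_1,\ldots,x_k\in\cup\mathcal{A}$ there exists $A\in\mathcal{A}$ such that $x_1,\ldots,x_\ell\in A$ and $\{x_{\ell+1},\ldots,x_k\}\cap A=\emptyset$. The class of all $k|\ell$-separated union-closed families is denoted by $\mathfrak{A}_{k|\ell}$.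 For natural numbers $k\geq\ell\geq1$, $\mathfrak{c}_{k|\ell}$ is the supremum of all positive real numbers $\epsilon$ satisfying the following condition: for every $\mathcal{A}\in\mathfrak{A}_{k|\ell}$ there exists a set $S\subseteq\cup\mathcal{A}$ with $|S|=k$ such that there are at least $\epsilon|\mathcal{A}|$ members $A$ of $\mathcal{A}$ satisfying $|S\cap A|\geq\ell$. If there is no such $\epsilon$, then $\mathfrak{c}_{k|\ell}:=0$. For natural numbers $k\geq\ell\geq1$, FC of order $k|\ell$ is the assertion: for every $\mathcal{A}\in\mathfrak{A}_{k|\ell}$ there exists a subset $S\subseteq\cup\mathcal{A}$ with $|S|=k$ such that the number of those members $A$ of $\mathcal{A}$ with $|A\cap S|\geq\ell$ is at least $\left(2^{-k}\sum_{i=\ell}^k\binom{k}{i}\right)|\mathcal{A}|$; in other words, $\mathfrak{c}_{k|\ell}=2^{-k}\sum_{i=\ell}^k\binom{k}{i}$. *)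

(* Defs.v *)
From HB Require Import structures.
From mathcomp Require Import all_boot all_order all_algebra.
Set Implicit Arguments.
Unset Strict Implicit.
Unset Printing Implicit Defensive.
Import Order.TTheory GRing.Theory Num.Theory.

(* A family determines its ground set, X = \bigcup A (i.e. [cover A]), but X is
   kept as an explicit argument.  Finite sets X are represented as subsets of an
   arbitrary finite type T. *)
Definition union_closed_on (T : finType) (X : {set T}) (A : {set {set T}}) :
    Prop :=
  [/\ X != set0,
      A \subset powerset X,
      set0 \in A,
      X \in A &
      forall B C : {set T}, B \in A -> C \in A -> B :|: C \in A].

(* The element x_j (1 <= j <= k) is [x i] with i = j - 1, so that x_1, ..., x_l
   are the [x i] with i < l. *)
Definition separated (k l : nat) (T : finType) (X : {set T})
    (A : {set {set T}}) : Prop :=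
  [/\ union_closed_on X A,
      k <= #|X| &
      forall x : 'I_k -> T, injective x -> (forall i, x i \in X) ->
        exists B : {set T},
          [/\ B \in A,
              forall i : 'I_k, i < l -> x i \in B &
              forall i : 'I_k, l <= i -> x i \notin B]].

Definition frankl_conjecture : Prop :=
  forall (T : finType) (X : {set T}) (A : {set {set T}}),
    union_closed_on X A ->
    exists2 x : T, x \in X &
      (2%:R^-1 * #|A|%:R <= #|[set B in A | x \in B]|%:R :> rat)%R.

Definition FC (k l : nat) : Prop :=
  forall (T : finType) (X : {set T}) (A : {set {set T}}),
    separated k l X A ->
    exists S : {set T},
      [/\ S \subset X,
          #|S| = k &
          ((2%:R ^- k * \sum_(l <= i < k.+1) 'C(k, i)%:R) * #|A|%:R
             <= #|[set B in A | (l <= #|B :&: S|)%N]|%:R :> rat)%R].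

(* Main.v *)
Require Import Defs.
From mathcomp Require Import all_boot all_order all_algebra.

(** Both additivity statements are proved by choosing [S] with [#|S| = k] from
    FC for [k] and applying FC for [k'] to a family on [X :\: S].  For order
    [k|1] this family consists of the members of [A] disjoint from [S]:
    separation of [A] makes it separated with ground set [X :\: S], and the two
    factors [2 ^- k] and [2 ^- k'] multiply.  For order [k|k], where separation
    only says that [X] has at least [k] elements, the family consists of the sets
    [B :\: S] for [S \subset B] in [A], together with the empty set; adding the
    empty set only strengthens the inequality obtained, since the empty set
    contains no nonempty [S'].  The Frankl conjecture yields FC of order [1|1]. *)

Import GRing.Theory Num.Theory.

Lemma sum_bin_ge1 k : \sum_(1 <= i < k.+1) 'C(k, i) = 2 ^ k - 1.
Proof.
rewrite -[2]/(1 + 1) expnDn big_ord_recl bin0 !exp1n addKn big_add1 big_mkord.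
by apply: eq_bigr => i _; rewrite !exp1n !muln1.
Qed.

Lemma scaled_le_rat (k c m n : nat) :
  ((2%:R ^- k * c%:R) * m%:R <= n%:R :> rat)%R = (c * m <= 2 ^ k * n).
Proof.
have p2 : (0 < 2%:R ^+ k :> rat)%R by rewrite exprn_gt0.
by rewrite -mulrA mulrC ler_pdivrMr // -natrX -!natrM ler_nat (mulnC n).
Qed.

Section Families.
Variable T : finType.
Implicit Types (X S Y B C : {set T}) (A : {set {set T}}).

(** The members meeting [S] are the complement in [A] of those disjoint from [S], and the binomial
    sum is [2 ^ k - 1]. Passing to the complement leaves a bare power of 2, so that bounds for two
    orders can be chained by multiplication. *)
Lemma FC1_boundE k S A :
  ((2%:R ^- k * \sum_(1 <= i < k.+1) 'C(k, i)%:R) * #|A|%:R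
     <= #|[set B in A | (1 <= #|B :&: S|)%N]|%:R :> rat)%R
  = (2 ^ k * #|[set B in A | [disjoint B & S]]| <= #|A|).
Proof.
rewrite -natr_sum scaled_le_rat sum_bin_ge1.
set a := #|[set B in A | 1 <= _]|; set b := #|[set B in A | [disjoint _ & _]]|.
have -> : #|A| = a + b.
  rewrite -(cardsID [set B | 1 <= #|B :&: S|] A) /a /b; congr (_ + _).
    by apply: eq_card => B; rewrite !inE.
  apply: eq_card => B; rewrite !inE andbC; congr (_ && _).
  by rewrite card_gt0 negbK setI_eq0.
by rewrite mulnBl mul1n leq_subLR mulnDr [_ + 2 ^ k * a]addnC leq_add2l.
Qed.

Lemma FCkk_boundE k S A : #|S| = k ->
  ((2%:R ^- k * \sum_(k <= i < k.+1) 'C(k, i)%:R) * #|A|%:R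
     <= #|[set B in A | (k <= #|B :&: S|)%N]|%:R :> rat)%R
  = (#|A| <= 2 ^ k * #|[set B in A | S \subset B]|).
Proof.
move=> cS; rewrite big_nat1 binn scaled_le_rat mul1n; congr (_ <= _ * _).
apply: eq_card => B; rewrite !inE; congr (_ && _); rewrite -cS.
apply/idP/idP => [le|/setIidPr -> //].
by apply/setIidPr/eqP; rewrite eqEcard subsetIr.
Qed.

Lemma union_closed_cover X A (D : {set {set T}}) :
  union_closed_on X A -> D \subset A -> cover D \in A.
Proof.
case=> _ _ A0 _ AU /subsetP DA; rewrite /cover.
by apply: (big_ind (fun B => B \in A)) => // B /DA.
Qed.

(** Replaces injective tuples by a point and a set to avoid. The set may have fewer than [k] points,
    because [k < #|X|] allows padding it with further points of [X]. *)
Lemma separated1P k X A :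
  separated k.+1 1 X A <->
  [/\ union_closed_on X A, k < #|X| &
      forall x Y, x \in X -> Y \subset X -> x \notin Y -> #|Y| <= k ->
        exists B, [/\ B \in A, x \in B & [disjoint B & Y]]].
Proof.
split=> [[ucA kX sepA]|[ucA kX sepA]]; split=> //.
  move=> x Y Xx YX Yx Yk.
  (* The first [k.+1] entries of this enumeration of [X] form the tuple: [x] comes first, then all
     of [Y], then padding. *)
  pose s := x :: enum Y ++ enum (X :\: (x |: Y)).
  have us : uniq s.
    rewrite /= cat_uniq !enum_uniq mem_cat !mem_enum !inE eqxx (negPf Yx) /=.
    rewrite andbT; apply/hasPn => y; rewrite !mem_enum !inE negb_or.
    by case/andP => /andP[].
  have sX : s =i X.
    move=> y; rewrite inE mem_cat !mem_enum !inE.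
    have [->|_] //= := eqVneq y x.
    by have [/(subsetP YX)|] := boolP (y \in Y).
  have ks : k < size s by rewrite -(card_uniqP us) (eq_card sX).
  have ltis (i : 'I_k.+1) : i < size s by apply: leq_trans ks.
  have [||B [AB Bin Bnot]] := sepA (fun i => nth x s i).
  - by move=> i j /eqP; rewrite nth_uniq // => /eqP /val_inj.
  - by move=> i; rewrite -sX mem_nth.
  exists B; split=> //; first exact: (Bin ord0).
  rewrite disjoint_sym disjoints_subset; apply/subsetP => y Yy; rewrite inE.
  (* The successor accounts for [x] at position 0 of [s]. *)
  have ltyk : (index y (enum Y)).+1 < k.+1.
    by rewrite ltnS (leq_trans _ Yk) // cardE index_mem mem_enum.
  have := Bnot (Ordinal ltyk) isT.
  by rewrite /= nth_cat index_mem mem_enum Yy nth_index ?mem_enum.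
move=> x xI xX.
have [||||B [AB Bx dB]] := sepA (x ord0) (x @: [set~ ord0]) => //.
- by apply/subsetP => _ /imsetP[i _ ->].
- by apply/imsetP => -[i]; rewrite !inE => i0 /xI ei; rewrite -ei eqxx in i0.
- by rewrite card_imset // cardsC1 card_ord.
exists B; split=> // i.
  by rewrite ltnS leqn0 => /eqP i0; rewrite (_ : i = ord0) //; apply: val_inj.
move=> i_gt0; apply/negP => Bi.
have := disjointFr dB Bi; rewrite imset_f // !inE.
by apply: contraTneq i_gt0 => ->.
Qed.

Lemma separated_kkE k X A :
  separated k k X A <-> union_closed_on X A /\ k <= #|X|.
Proof.
split=> [[]//|[ucA kX]]; split=> // x _ xX; exists X; split=> //.
  by case: ucA.
by move=> i; rewrite leqNgt ltn_ord.
Qed.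

(** To avoid [Y] inside the subfamily, avoid [S :|: Y] in [A]: this set has at most [k + k'] points,
    exactly what the order of [A] permits. *)
Lemma separated1_avoid k k' X A S :
  separated (k + k'.+1) 1 X A -> S \subset X -> #|S| = k ->
  separated k'.+1 1 (X :\: S) [set B in A | [disjoint B & S]].
Proof.
set A' := [set B in A | _].
rewrite addnS => /separated1P[ucA kX sepA] SX cS.
have cXS : k' < #|X :\: S|.
  by rewrite cardsD (setIidPr SX) cS ltn_subRL.
have sepS x Y : x \in X :\: S -> Y \subset X :\: S -> x \notin Y -> #|Y| <= k' ->
    exists B, [/\ B \in A', x \in B & [disjoint B & Y]].
  rewrite inE subsetD => /andP[Sx Xx] /andP[YX _] Yx Yk.
  have [||||B [AB Bx]] := sepA x (S :|: Y) => //.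
  - by rewrite subUset SX.
  - by rewrite inE negb_or Sx.
  - by rewrite (leq_trans (leq_card_setU S Y)) // cS leq_add2l.
  rewrite disjoints_subset setCU subsetI -!disjoints_subset => /andP[dS dY].
  by exists B; rewrite inE AB.
apply/separated1P; split=> //; have [X0 AX A0 XA AU] := ucA.
split.
- by rewrite -card_gt0 (leq_trans _ cXS).
- apply/subsetP => B; rewrite !inE => /andP[/(subsetP AX)].
  by rewrite inE subsetD => -> ->.
- by rewrite inE A0 disjoints_subset sub0set.
(* Separation with nothing further to avoid puts each point of [X :\: S] in a member of [A'], so the
   ground set is a union of members. *)
- have -> : X :\: S = cover A'.
    apply/eqP; rewrite eqEsubset; apply/andP; split; apply/subsetP => x.
      move=> xXS; have [B [AB Bx _]] : exists B, [/\ B \in A', x \in B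
                                                    & [disjoint B & set0]].
        by apply: sepS; rewrite ?sub0set ?in_set0 ?cards0.
      by apply/bigcupP; exists B.
    case/bigcupP => B; rewrite !inE => /andP[/(subsetP AX)].
    by rewrite inE => /subsetP BX dB Bx; rewrite (disjointFr dB Bx) BX.
  rewrite inE (union_closed_cover X) //=; last first.
    by apply/subsetP => B; rewrite inE => /andP[].
  rewrite disjoint_sym bigcup_disjoint // => B.
  by rewrite inE disjoint_sym => /andP[].
- move=> B C; rewrite !inE => /andP[AB dB] /andP[AC dC].
  by rewrite AU //= disjoints_subset subUset -!disjoints_subset dB.
Qed.

(** Removing [S] commutes with unions. The empty set is adjoined because [S] itself may fail to
    belong to [A]. *)
Lemma union_closed_link X A S :
  union_closed_on X A -> S \proper X ->
  union_closed_on (X :\: S) (set0 |: [set B :\: S | B in A & S \subset B]).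
Proof.
case=> _ AX A0 XA AU ltSX; have [SX _] := andP ltSX.
have inl B : B \in A -> S \subset B ->
    B :\: S \in [set B :\: S | B in A & S \subset B].
  by move=> AB SB; apply: imset_f; rewrite inE AB.
split; rewrite ?setU11 //.
- by rewrite -card_gt0 cardsD (setIidPr SX) subn_gt0 proper_card.
- apply/subsetP => B; rewrite !inE => /predU1P[->|]; first exact: sub0set.
  case/imsetP => C; rewrite inE => /andP[/(subsetP AX)]; rewrite inE => CX _ ->.
  exact: setSD.
- by rewrite inE inl ?orbT.
move=> B C; rewrite !in_setU1 => /predU1P[->|AB]; first by rewrite set0U.
case/predU1P=> [->|AC]; first by rewrite setU0 AB orbT.
case/imsetP: AB => B'; rewrite inE => /andP[{}AB SB] ->.
case/imsetP: AC => C'; rewrite inE => /andP[{}AC SC] ->.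
by rewrite -setDUl inl ?orbT ?AU // subsetU ?SB.
Qed.
End Families.

Lemma FC1_add k k' : FC k.+1 1 -> FC k'.+1 1 -> FC (k.+1 + k'.+1) 1.
Proof.
move=> FCk FCk' T X A sepA.
have [|S [SX cS]] := FCk T X A.
  have := sepA; rewrite addSn => /separated1P[ucA kX sepA'].
  apply/separated1P; split=> // [|x Y Xx YX Yx Yk].
    by apply: leq_trans kX; rewrite ltnS leq_addr.
  by apply: sepA' => //; rewrite (leq_trans Yk) ?leq_addr.
rewrite FC1_boundE => leS.
have [S' [S'X cS']] := FCk' _ _ _ (@separated1_avoid _ _ _ _ _ _ sepA SX cS).
rewrite FC1_boundE => leS'.
have [S'X' dS'S] : S' \subset X /\ [disjoint S' & S].
  by apply/andP; rewrite -subsetD.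
exists (S :|: S'); rewrite FC1_boundE; split.
- by rewrite subUset SX.
- by rewrite cardsU setIC (disjoint_setI0 dS'S) cards0 subn0 cS cS'.
apply: (leq_trans _ leS); rewrite expnD -mulnA leq_mul2l; apply/orP; right.
apply: (leq_trans _ leS'); rewrite leq_mul2l; apply/orP; right.
(* A set avoids [S :|: S'] exactly when it avoids both parts. *)
apply: subset_leq_card; apply/subsetP => B; rewrite !inE.
by rewrite disjoints_subset setCU subsetI -!disjoints_subset andbA.
Qed.

Lemma FCkk_add k k' : 0 < k' -> FC k k -> FC k' k' -> FC (k + k') (k + k').
Proof.
move=> k'_gt0 FCk FCk' T X A /separated_kkE[ucA kX].
have [|S [SX cS]] := FCk T X A.
  by apply/separated_kkE; split=> //; apply: leq_trans kX; rewrite leq_addr.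
rewrite FCkk_boundE // => leS.
(* Since [k'] is positive, [S] cannot exhaust [X]. *)
have ltSX : S \proper X.
  rewrite properEcard SX cS (leq_trans _ kX) //.
  by rewrite -addn1 leq_add2l.
have [|S' [S'X cS']] := FCk' T (X :\: S)
                          (set0 |: [set B :\: S | B in A & S \subset B]).
  apply/separated_kkE; split; first exact: union_closed_link ucA ltSX.
  by rewrite cardsD (setIidPr SX) cS leq_subRL // (leq_trans (leq_addr _ _) kX).
rewrite FCkk_boundE // => leS'.
have [S'X' dS'S] : S' \subset X /\ [disjoint S' & S].
  by apply/andP; rewrite -subsetD.
have cSS' : #|S :|: S'| = k + k'.
  by rewrite cardsU setIC (disjoint_setI0 dS'S) cards0 subn0 cS cS'.
exists (S :|: S'); rewrite FCkk_boundE //; split=> //.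
  by rewrite subUset SX.
apply: (leq_trans leS); rewrite expnD -mulnA leq_mul2l; apply/orP; right.
(* On sets containing [S], removing [S] is injective, so the members above [S] can be counted in the
   link. *)
rewrite -(card_in_imset (f := fun B => B :\: S)); last first.
  move=> B C; rewrite !inE => /andP[_ SB] /andP[_ SC] eqBC.
  by rewrite -(setID B S) -(setID C S) eqBC (setIidPr SB) (setIidPr SC).
apply: leq_trans (subset_leq_card (subsetUr [set set0] _)) _.
apply: (leq_trans leS'); rewrite leq_mul2l; apply/orP; right.
apply: leq_trans (leq_imset_card (fun B => B :\: S) _).
apply: subset_leq_card; apply/subsetP => C; rewrite inE => /andP[].
case/setU1P => [->|]; first by rewrite subset0 -cards_eq0 cS' eqn0Ngt k'_gt0.
case/imsetP => B; rewrite inE => /andP[AB SB] ->; rewrite subsetD => /andP[S'B _].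
by apply: imset_f; rewrite inE AB subUset SB.
Qed.

Lemma frankl_FC11 : frankl_conjecture -> FC 1 1.
Proof.
move=> frankl T X A [ucA _ _].
have [x Xx le] := frankl T X A ucA.
exists [set x]; rewrite sub1set Xx cards1; split=> //.
rewrite big_nat1 binn mulr1 expr1; apply: Order.POrderTheory.le_trans le _.
rewrite ler_nat; apply: subset_leq_card; apply/subsetP => B; rewrite !inE.
by case/andP=> -> Bx; rewrite card_gt0; apply/set0Pn; exists x; rewrite !inE Bx /=.
Qed.

Theorem theorem5 (k k' : nat) (hk : 1 <= k) (hk' : 1 <= k') :
  ((FC k 1 -> FC k' 1 -> FC (k + k') 1) /\
   (frankl_conjecture -> FC k 1)) /\
  ((FC k k -> FC k' k' -> FC (k + k') (k + k')) /\
   (frankl_conjecture -> FC k k)).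
Proof.
split; split.
- by case: k hk => // k _; case: k' hk' => // k' _; apply: FC1_add.
- move=> /frankl_FC11 F11; case: k hk => // k _.
  (* The order grows by one at each step, by adding the case of order [1|1]. *)
  by elim: k => // k IHk; rewrite -[k.+2]addn1; apply: FC1_add.
- exact: FCkk_add.
- move=> /frankl_FC11 F11; case: k hk => // k _.
  by elim: k => // k IHk; rewrite -[k.+2]addn1; apply: FCkk_add.
Qed.
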